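(* Let $G$ be a graph on $n$ vertices with chromatic number $\chi(G)$ and independence number $\alpha(G)$. Then: (i) $\varphi(G) \leq n-\chi(G)$; (ii) $\varphi(G) \leq \chi(G)\left(1-\dfrac{1}{\alpha(G)}\right)$; (iii) $\varphi(G) \leq n/3$.
   Context: All graphs are finite, simple and undirected, with at least one vertex. $\chi$ denotes the chromatic number. For a proper vertex coloring $c$ of $G$ and an induced subgraph $H$ of $G$, let $c(H)$ be the set of colors used by $c$ on the vertices of $H$. Define $\varphi_c(G)=\max_{H}\,(|c(H)|-\chi(H))$, the maximum over all induced subgraphs $H$ of $G$. The chromatic discrepancy is $\varphi(G)=\min_c \varphi_c(G)$, the minimum over all proper colorings $c$ of $G$ (with any number of colors). *)

(* Defs.v *)
From HB Require Import structures.
From mathcomp Require Import all_boot all_order all_algebra.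
From mathcomp Require Import boolp.

Set Implicit Arguments.
Unset Strict Implicit.
Unset Printing Implicit Defensive.

Record sgraph := SGraph {
  vertex :> finType;
  adj : rel vertex;
  adj_sym : symmetric adj;
  adj_irrefl : irreflexive adj }.

Section Induced.
Variables (G : sgraph) (S : {set G}).

Definition induced_adj : rel {x : G | x \in S} :=
  fun x y => adj (val x) (val y).

Lemma induced_adj_sym : symmetric induced_adj.
Proof. by move=> x y; exact: adj_sym. Qed.

Lemma induced_adj_irrefl : irreflexive induced_adj.
Proof. by move=> x; exact: adj_irrefl. Qed.

Definition induced : sgraph := SGraph induced_adj_sym induced_adj_irrefl.

End Induced.

Definition proper_coloring (G : sgraph) (C : eqType) (c : G -> C) : bool :=
  [forall x : G, forall y : G, adj x y ==> (c x != c y)].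

Lemma enum_rank_proper (G : sgraph) : proper_coloring (@enum_rank G).
Proof.
apply/forallP => x; apply/forallP => y; apply/implyP => xy.
by apply: contraTneq xy => /enum_rank_inj ->; rewrite adj_irrefl.
Qed.

Definition colorable (G : sgraph) (k : nat) : bool :=
  [exists c : {ffun G -> 'I_k}, proper_coloring c].

Lemma ex_colorable (G : sgraph) : exists k, colorable G k.
Proof.
exists #|G|; apply/existsP; exists [ffun x => enum_rank x].
apply/forallP => x; apply/forallP => y; rewrite !ffunE.
by have /forallP/(_ x)/forallP/(_ y) := enum_rank_proper G.
Qed.

Definition chromatic_number (G : sgraph) : nat := ex_minn (ex_colorable G).

Definition independent (G : sgraph) (S : {set G}) : bool :=
  [forall x in S, forall y in S, ~~ adj x y].

Definition independence_number (G : sgraph) : nat :=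
  \max_(S : {set G} | independent S) #|S|.

(* The truncated subtraction below is exact when c is proper. *)
Lemma chromatic_number_induced_le (G : sgraph) (C : finType) (c : G -> C)
    (S : {set G}) :
  proper_coloring c -> chromatic_number (induced S) <= #|c @: S|.
Proof.
move=> cP; rewrite /chromatic_number; case: ex_minnP => m _; apply.
have cS (x : induced S) : c (val x) \in c @: S.
  by apply: imset_f; exact: (valP x).
apply/existsP.
exists [ffun x : induced S => enum_rank_in (cS x) (c (val x))].
apply/forallP => x; apply/forallP => y; apply/implyP => xy; rewrite !ffunE.
have /forallP/(_ (val x))/forallP/(_ (val y))/implyP/(_ xy) := cP.
apply: contra_neq => exy.
rewrite -(enum_rankK_in (cS x) (cS x)) exy.
by rewrite enum_rankK_in ?cS.
Qed.

Definition coloring_discrepancy (G : sgraph) (C : finType) (c : G -> C) : nat :=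
  \max_(S : {set G} | S != set0) (#|c @: S| - chromatic_number (induced S)).

Definition discrepancy_value (G : sgraph) (d : nat) : Prop :=
  exists (k : nat) (c : G -> 'I_k),
    proper_coloring c /\ coloring_discrepancy c = d.

Lemma ex_discrepancy_value (G : sgraph) : exists d, `[< discrepancy_value G d >].
Proof.
exists (coloring_discrepancy (@enum_rank G)); apply/asboolP.
by exists #|G|, (@enum_rank G); split => //; exact: enum_rank_proper.
Qed.

Definition chromatic_discrepancy (G : sgraph) : nat :=
  ex_minn (ex_discrepancy_value G).

(* Main.v *)
Require Import Defs.
From mathcomp Require Import all_boot all_order all_algebra.
From mathcomp Require Import boolp zify.

(* (i) Give all vertices different colors and use that deleting t vertices
   lowers the chromatic number by at most t.
   (ii) In an optimal coloring, a subgraph H that sees p <= chi(G) colors has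
   at least p vertices, so chi(H) >= p / alpha(G).
   (iii) If alpha <= 2, the bounds n - chi and chi / 2 of (i) and (ii) cannot
   both exceed n / 3.  Otherwise remove an independent set of size 3, color the
   rest by induction, and give the removed set one new color: this raises the
   discrepancy by at most 1. *)

Set Implicit Arguments.
Unset Strict Implicit.
Unset Printing Implicit Defensive.

Import Order.TTheory GRing.Theory Num.Theory.

Lemma proper_coloringP (G : sgraph) (C : eqType) (c : G -> C) :
  reflect (forall x y, adj x y -> c x != c y) (proper_coloring c).
Proof.
apply: (iffP forallP) => [cP x y | cP x].
  by have /forallP/(_ y)/implyP := cP x.
by apply/forallP => y; apply/implyP; exact: cP.
Qed.

Lemma chromatic_number_le (G : sgraph) (C : finType) (c : G -> C) :
  proper_coloring c -> chromatic_number G <= #|c @: setT|.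
Proof.
move=> /proper_coloringP cP; rewrite /chromatic_number.
case: ex_minnP => m _; apply; apply/existsP.
have cT x : c x \in c @: setT by exact: imset_f.
exists [ffun x => enum_rank_in (cT x) (c x)].
apply/proper_coloringP => x y /cP; rewrite !ffunE; apply: contra_neq => exy.
by rewrite -(enum_rankK_in (cT x) (cT x)) exy enum_rankK_in.
Qed.

Lemma chromatic_number_colorable (G : sgraph) : colorable G (chromatic_number G).
Proof. by rewrite /chromatic_number; case: ex_minnP. Qed.

Section SubsetColorings.
Variable G : sgraph.
Implicit Types (A I S T : {set G}) (C : finType).

(** Colorings stay defined on all of [G], with values off [A] arbitrary. They restrict to smaller
    sets without passing to nested induced subgraphs. *)
Definition proper_on A C (c : G -> C) :=
  forall x y, x \in A -> y \in A -> adj x y -> c x != c y.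

Lemma proper_on_sub C (c : G -> C) S T :
  S \subset T -> proper_on T c -> proper_on S c.
Proof. by move=> /subsetP ST cP x y /ST xT /ST yT; exact: cP. Qed.

Definition chi A := chromatic_number (induced A).

Lemma chi_le C (c : G -> C) A : proper_on A c -> chi A <= #|c @: A|.
Proof.
move=> cP.
have cvP : proper_coloring (fun x : induced A => c (val x)).
  apply/proper_coloringP => x y xy.
  by apply: cP => //; [exact: (valP x) | exact: (valP y)].
apply: leq_trans (chromatic_number_le cvP) _; apply/subset_leq_card/subsetP.
by move=> _ /imsetP[x _ ->]; apply: imset_f; exact: (valP x).
Qed.

Lemma chi_coloring A :
  exists C (c : G -> C), proper_on A c /\ #|c @: A| <= chi A.
Proof.
have /existsP[c /proper_coloringP cP] := chromatic_number_colorable (induced A).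
(* [None] is a default off [A]: it keeps the color type inhabited when [chi A] is 0, and no vertex
   of [A] receives it. *)
pose c' (x : G) := if insub x is Some u then Some (c u) else None.
have c'E x (xA : x \in A) : c' x = Some (c (Sub x xA)).
  by rewrite /c' insubT.
exists (option 'I_(chi A)), c'; split.
  move=> x y xA yA xy; rewrite (c'E _ xA) (c'E _ yA).
  by rewrite (inj_eq (@Some_inj _)); exact: cP.
have sub : c' @: A \subset Some @: [set: 'I_(chi A)].
  by apply/subsetP => _ /imsetP[x xA ->]; rewrite (c'E _ xA) imset_f.
apply: leq_trans (subset_leq_card sub) _.
by rewrite card_imset ?cardsT ?card_ord //; exact: Some_inj.
Qed.

Lemma chi_setT : chi setT = chromatic_number G.
Proof.
apply/eqP; rewrite eqn_leq; apply/andP; split.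
  have /existsP[c /proper_coloringP cP] := chromatic_number_colorable G.
  have cT : proper_on setT c by move=> x y _ _; exact: cP.
  apply: leq_trans (chi_le cT) _; apply: leq_trans (max_card _) _.
  by rewrite card_ord.
have [C [c [cP]]] := chi_coloring setT; apply: leq_trans.
by apply: chromatic_number_le; apply/proper_coloringP => x y; apply: cP.
Qed.

Lemma chi_mono S T : S \subset T -> chi S <= chi T.
Proof.
move=> ST; have [C [c [cP cT]]] := chi_coloring T.
apply: leq_trans (chi_le (proper_on_sub ST cP)) _.
exact: leq_trans (subset_leq_card (imsetS _ ST)) cT.
Qed.

(** Color [S] optimally and give each vertex outside [S] a private color. *)
Lemma chi_setD S T : chi T <= chi S + #|T :\: S|.
Proof.
have [C [c [cP cS]]] := chi_coloring S.
pose c' x : C + G := if x \in S then inl (c x) else inr x.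
have c'P : proper_on T c'.
  move=> x y _ _ xy; rewrite /c'.
  case: ifP => xS; case: ifP => yS //; first by apply: cP.
  by apply: contraTneq xy => -[->]; rewrite adj_irrefl.
apply: leq_trans (chi_le c'P) _.
have sub : c' @: T \subset (inl @: (c @: S)) :|: (inr @: (T :\: S)).
  apply/subsetP => _ /imsetP[x xT ->]; rewrite /c' inE.
  by case: ifP => xS; rewrite !imset_f ?orbT // inE xS.
apply: leq_trans (subset_leq_card sub) _.
apply: leq_trans (leq_card_setU _ _) _.
rewrite leq_add ?leq_imset_card //.
exact: leq_trans (leq_imset_card _ _) cS.
Qed.

(** The color classes of an optimal coloring are independent, so each has at most [m] vertices. *)
Lemma card_le_chi A m :
  (forall I, I \subset A -> independent I -> #|I| <= m) -> #|A| <= chi A * m.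
Proof.
move=> Am; have [C [c [cP cA]]] := chi_coloring A.
rewrite (leq_trans _ (leq_mul cA (leqnn m))) //.
rewrite (card_partition (preim_partitionP c A)) -sum_nat_const.
(* Indexing the classes by their colors turns the cardinality into a sum over [c @: A]. *)
have -> : preim_partition c A = (fun v => [set x in A | c x == v]) @: (c @: A).
  apply/setP => B; apply/imsetP/imsetP => [[x xA ->]|[_ /imsetP[x xA ->] ->]].
    exists (c x); first exact: imset_f.
    by apply/setP => y; rewrite !inE eq_sym.
  by exists x => //; apply/setP => y; rewrite !inE eq_sym.
rewrite big_imset /=; last first.
  move=> _ v /imsetP[x xA ->] _ /setP/(_ x).
  by rewrite !inE xA eqxx => /esym/eqP.
apply: leq_sum => v _; apply: Am.
  by apply/subsetP => x; rewrite inE => /andP[].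
apply/forall_inP => x; rewrite inE => /andP[xA /eqP cx].
apply/forall_inP => y; rewrite inE => /andP[yA /eqP cy].
by apply/negP => /(cP _ _ xA yA); rewrite cx cy eqxx.
Qed.

(** The additive form avoids truncated subtraction, and any finite color type is allowed so that new
    colors can be adjoined. *)
Definition discrepancy_on_le A d :=
  exists C (c : G -> C), proper_on A c /\
    forall S, S \subset A -> #|c @: S| <= chi S + d.

Lemma chromatic_discrepancy_le d :
  discrepancy_on_le setT d -> chromatic_discrepancy G <= d.
Proof.
move=> [C [c [cP cd]]]; rewrite /chromatic_discrepancy.
case: ex_minnP => m _ m_min.
(* The discrepancy is defined with colors in an ordinal, so colors are replaced by their ranks. *)
pose c' x := enum_rank (c x).
apply: (@leq_trans (coloring_discrepancy c')).
  apply: m_min; apply/asboolP; exists #|C|, c'; split=> //.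
  apply/proper_coloringP => x y xy; rewrite (inj_eq enum_rank_inj).
  exact: cP.
apply/bigmax_leqP => S _; rewrite leq_subLR.
apply: leq_trans (cd S (subsetT S)).
have -> : c' @: S = enum_rank @: (c @: S) by rewrite -imset_comp.
exact: leq_imset_card.
Qed.

Lemma discrepancy_on_le_card A : discrepancy_on_le A (#|A| - chi A).
Proof.
exists G, id; split=> [x y _ _ xy|S SA].
  by apply: contraTneq xy => ->; rewrite adj_irrefl.
rewrite imset_id; have := chi_setD S A; have := subset_leq_card SA.
have := cardsD A S; rewrite (setIidPr SA); lia.
Qed.

(** The last hypothesis says that [d] is at least the floor of [(m - 1) * chi A / m]. If [S] sees
    [p] colors, then [p <= m * chi S] and [p <= chi A], hence [m * (p - chi S) <= (m - 1) * p <= (m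
    - 1) * chi A < m * (d + 1)]. *)
Lemma discrepancy_on_le_chi A m d :
  (forall I, I \subset A -> independent I -> #|I| <= m) ->
  0 < m -> m.-1 * chi A < m * d.+1 -> discrepancy_on_le A d.
Proof.
move=> Am m0 md; have [C [c [cP cA]]] := chi_coloring A.
exists C, c; split=> // S SA.
have Sm : #|S| <= chi S * m.
  by apply: card_le_chi => I IS; apply: Am; exact: subset_trans SA.
have cS := leq_imset_card c S.
have cSA := leq_trans (subset_leq_card (imsetS c SA)) cA.
case: m m0 md {Am} Sm => // m _ /= md Sm; nia.
Qed.

Lemma discrepancy_on_le_independent A I d :
  independent I -> discrepancy_on_le (A :\: I) d -> discrepancy_on_le A d.+1.
Proof.
move=> /forall_inP indI [C [c [cP cd]]].
pose c' x := if x \in I then None else Some (c x).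
exists (option C), c'; split.
  move=> x y xA yA xy; rewrite /c'; case: ifP => xI; case: ifP => yI //.
    by have /forall_inP/(_ y yI) := indI x xI; rewrite xy.
  by rewrite (inj_eq (@Some_inj _)); apply: cP; rewrite ?inE ?xI ?yI.
move=> S SA; have DSA : S :\: I \subset A :\: I by exact: setSD.
have sub : c' @: S \subset None |: Some @: (c @: (S :\: I)).
  apply/subsetP => _ /imsetP[x xS ->]; rewrite /c' in_setU1.
  by case: ifP => xI //=; rewrite !imset_f // inE xI.
apply: leq_trans (subset_leq_card sub) _.
(* The color [None] accounts for the extra 1; the other colors on [S] all occur on [S :\: I]. *)
rewrite cardsU1 addnS -addn1 addnC leq_add ?leq_b1 //.
apply: leq_trans (leq_imset_card _ _) _; apply: leq_trans (cd _ DSA) _.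
by rewrite leq_add2r chi_mono ?subsetDl.
Qed.

Lemma independent_sub S T : S \subset T -> independent T -> independent S.
Proof.
move=> /subsetP ST /forall_inP iT; apply/forall_inP => x /ST /iT /forall_inP Tx.
by apply/forall_inP => y /ST /Tx.
Qed.

Lemma discrepancy_on_le_third A : discrepancy_on_le A (#|A| %/ 3).
Proof.
have [n] := ubnP #|A|; elim: n A => // n IHn A An.
have [/exists_inP[I IA /andP[indI I3]]|no3] :=
  boolP [exists I : {set G} in powerset A, independent I && (2 < #|I|)].
  have [J [JI J3]] : exists J : {set G}, J \subset I /\ #|J| = 3.
    (* Trimming to exactly three vertices makes [#|A| %/ 3] drop by exactly one. *)
    exists [set x in take 3 (enum I)]; split.
      by apply/subsetP => x; rewrite inE => /mem_take; rewrite mem_enum.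
    rewrite cardsE (card_uniqP _) ?take_uniq ?enum_uniq //.
    by rewrite size_takel // -cardE.
  have JA : J \subset A by apply: subset_trans JI _; rewrite -powersetE.
  have cD : #|A| = #|A :\: J| + 3.
    by rewrite cardsD (setIidPr JA) J3 subnK // -J3 subset_leq_card.
  rewrite (_ : _ %/ 3 = (#|A :\: J| %/ 3).+1); last lia.
  apply: discrepancy_on_le_independent (independent_sub JI indI) _.
  by apply: IHn; lia.
have A2 I : I \subset A -> independent I -> #|I| <= 2.
  move=> IA indI; rewrite leqNgt; apply: contra no3 => I3.
  by apply/exists_inP; exists I; rewrite ?powersetE // indI.
have [chiA|chiA] := leqP (3 * (#|A| - chi A)) #|A|.
  have [C [c [cP cd]]] := discrepancy_on_le_card A.
  exists C, c; split=> // S /cd; lia.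
(* Here [3 * chi A < 2 * #|A|], which gives [chi A < 2 * (#|A| %/ 3).+1]. *)
by apply: (discrepancy_on_le_chi A2) => //; lia.
Qed.

End SubsetColorings.

Lemma independence_number_gt0 (G : sgraph) : 0 < #|G| -> 0 < independence_number G.
Proof.
move=> /card_gt0P[x _].
rewrite -(cards1 x); apply: leq_bigmax_cond.
apply/forall_inP => y /set1P->; apply/forall_inP => z /set1P->.
by rewrite adj_irrefl.
Qed.

Local Open Scope ring_scope.

Theorem theorem3p4 (G : sgraph) (hG : (0 < #|G|)%N) :
  [/\ (chromatic_discrepancy G)%:R
        <= #|G|%:R - (chromatic_number G)%:R :> rat,
      (chromatic_discrepancy G)%:R
        <= (chromatic_number G)%:R
             * (1 - 1 / (independence_number G)%:R) :> rat
    & (chromatic_discrepancy G)%:R <= #|G|%:R / 3%:R :> rat].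
Proof.
split.
- have := chromatic_discrepancy_le (discrepancy_on_le_card [set: G]).
  rewrite cardsT chi_setT => le_sub.
  have := chromatic_number_le (enum_rank_proper G).
  rewrite card_imset ?cardsT; last exact: enum_rank_inj.
  by move=> le_n; rewrite -natrB // ler_nat.
- have a0 := independence_number_gt0 hG.
  set a := independence_number G in a0 *; set k := chromatic_number G.
  (* The floor is the least [d] that [discrepancy_on_le_chi] admits; clearing the denominator then
     gives the rational bound. *)
  have : (chromatic_discrepancy G <= (a.-1 * k) %/ a)%N.
    apply: chromatic_discrepancy_le.
    apply: (discrepancy_on_le_chi (m := a)) => // [I _ indI|].
      exact: leq_bigmax_cond.
    by rewrite chi_setT [ltnRHS]mulnC -/k ltn_ceil.
  rewrite leq_divRL // -(ler_nat rat) !natrM -subn1 natrB //.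
  have a0' : 0 < a%:R :> rat by rewrite ltr0n.
  rewrite -ler_pdivlMr //; congr (_ <= _).
  by rewrite mulrAC mulrC mulrBl divff // gt_eqF.
- have := chromatic_discrepancy_le (discrepancy_on_le_third [set: G]).
  by rewrite cardsT leq_divRL // -(ler_nat rat) natrM -ler_pdivlMr.
Qed.
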